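(* Let $\Sigma$ be an $m$-manifold, $m\ge2$, $n=m+1\geq 3$, let $\Lambda$ be an immersed hypersurface $\Sigma\to\mathbb{R}P^n$, and let $g$ be a metric on $\Sigma\times\mathbb{R}^{n+1}$ representing a congruence of quadrics enveloped by the contact lift $E$ of $\Lambda$. Suppose that $\mathcal{N}^g$, viewed as a bundle map $T\Sigma\to\Sigma\times\mathfrak{gl}(\mathbb{R}^{n+1})$, has codimension one kernel in $T\Sigma$. Then $E$ is M\''obius-flat, with $\chi^g=0=\psi^g$.
   Context: Everything is smooth. $\underline{\mathbb{R}}^{n+1}=\Sigma\times\mathbb{R}^{n+1}$ with trivial connection $d$; $\underline{\mathfrak g}=\Sigma\times\mathfrak{gl}(\mathbb{R}^{n+1})$. For endomorphism-valued one-forms, $[\alpha\wedge\beta]_{X,Y}=[\alpha_X,\beta_Y]-[\alpha_Y,\beta_X]$. A map into $\mathbb{R}P^n$ is identified with a line subbundle $\Lambda\subset\underline{\mathbb{R}}^{n+1}$. Its contact lift $E$ is the filtration $0\subset E_1=\Lambda\subset E_2\subset\underline{\mathbb{R}}^{n+1}$, where $E_2$ is the rank $n$ bundle spanned by the values of $\sigma$ and $d_X\sigma$ for $\sigma$ a section of $\Lambda$ and $X$ a vector field. Put $\underline{\mathfrak g}_{-2}=\{X: XE_2=0,\ X\underline{\mathbb{R}}^{n+1}\subseteq E_1\}$, $\underline{\mathfrak g}_{-1}=\{X: XE_1=0,\ XE_2\subseteq E_1\}$, $\underline{\mathfrak g}_0=\{X: XE_1\subseteq E_1,\ XE_2\subseteq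 E_2\}$. A metric $g$ on $\underline{\mathbb{R}}^{n+1}$ is a non-degenerate symmetric bilinear form on the fibres (any signature); at each point it represents the quadric $\{g=0\}$ in $\mathbb{R}P^n$. There is a unique decomposition $d=\mathcal{D}^g+\mathcal{N}^g$ with $\mathcal{D}^g$ a connection such that $\mathcal{D}^gg=0$ and $\mathcal{N}^g$ a one-form with $g$-symmetric values. $\mathfrak h\subset\underline{\mathfrak g}$ is the bundle of $g$-skew endomorphisms. $E$ envelopes $g$ if $E_1$ is $g$-null and $\mathcal{N}^g$ takes values in $\underline{\mathfrak g}_0$ (geometrically, the hypersurface and the quadric have second-order contact at each point). $R^{\nabla}$ denotes curvature and $d^{\nabla}$ the exterior covariant derivative on endomorphism-valued forms. $E$ is M\''obius-flat if for some enveloped metric $g$ there exist one-forms $\chi^g\in\Omega^1(\Sigma,\underline{\mathfrak g}_{-1}\cap\mathfrak h)$ and $\psi^g\in\Omega^1(\Sigma,\underline{\mathfrak g}_{-2})$ with $d^{\mathcal{D}^g}\chi^g=R^{\mathcal{D}^g}$ and $d\psi^g+[\mathcal{N}^g\wedge\chi^g]=0$. *)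

(* Defs.v *)
From HB Require Import structures.
From mathcomp Require Import all_boot all_order all_algebra.
From mathcomp Require Import all_classical all_reals topology normedtype derive.
From mathcomp Require Import ring.
Set Implicit Arguments. Unset Strict Implicit. Unset Printing Implicit Defensive.
Import Order.TTheory GRing.Theory Num.Theory.
Import numFieldNormedType.Exports.
Local Open Scope classical_set_scope.
Local Open Scope ring_scope.

Section EuclideanSmoothness.
Variables (R : realType) (m : nat).
Implicit Types (U : set 'rV[R]_m) (f g : 'rV[R]_m -> R) (k : nat).

Definition basis_vec (i : 'I_m) : 'rV[R]_m := delta_mx 0 i.

(* Class C^k on an open set U; the values of f outside U are irrelevant. *)
Fixpoint Ck k U f : Prop :=
  (forall x, U x -> {for x, continuous f}) /\
  if k is k'.+1 then
    forall i, (forall x, U x -> derivable f x (basis_vec i)) /\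
              Ck k' U ('D_(basis_vec i) f)
  else True.

Definition smooth_on U f := forall k, Ck k U f.

Let near_ext U f g x : open U -> (forall x, U x -> f x = g x) -> U x ->
  {near x, f =1 g}.
Proof.
move=> oU fg Ux; have Un : nbhs x U by exact: open_nbhs_nbhs.
by apply: filterS Un => y /fg.
Qed.

Let continuous_ext U f g x : open U -> (forall x, U x -> f x = g x) -> U x ->
  {for x, continuous f} -> {for x, continuous g}.
Proof.
move=> oU fg Ux; rewrite /prop_for /continuous_at -(fg x Ux).
move=> cf; apply: (cvg_trans _ cf).
by apply: (@near_eq_cvg _ _ (nbhs x)); exact: near_ext oU fg Ux.
Qed.

Lemma Ck_ext k U f g : open U -> (forall x, U x -> f x = g x) ->
  Ck k U f -> Ck k U g.
Proof.
move=> oU; elim: k f g => [|k IH] f g fg [cf df].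
  by split=> // x Ux; exact: continuous_ext oU fg Ux (cf x Ux).
split=> [x Ux|i]; first exact: continuous_ext oU fg Ux (cf x Ux).
have [d1 d2] := df i; split=> [x Ux|].
  by apply: near_eq_derivable (d1 x Ux); exact: near_ext oU fg Ux.
by apply: IH d2 => x Ux; apply: near_eq_derive; exact: near_ext oU fg Ux.
Qed.

Lemma CkS k U f : Ck k.+1 U f -> Ck k U f.
Proof.
elim: k f => [|k IH] f; first by case.
by case=> cf df; split=> // i; have [d1 /IH d2] := df i.
Qed.

Lemma Ck_continuous k U f : Ck k U f -> forall x, U x -> {for x, continuous f}.
Proof. by case: k => [|k] []. Qed.

Lemma Ck_cst k U (a : R) : Ck k U (cst a).
Proof.
elim: k a => [|k IH] a; (split=> [x _|]; first exact: cst_continuous) => // i.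
split=> [x _|]; first exact: derivable_cst.
suff -> : 'D_(basis_vec i) (cst a) = cst 0 :> ('rV[R]_m -> R) by [].
by apply/funext => x; rewrite derive_cst.
Qed.

Lemma CkD k U f g : open U -> Ck k U f -> Ck k U g -> Ck k U (f + g).
Proof.
move=> oU; elim: k f g => [|k IH] f g [cf df] [cg dg];
  (split=> [x Ux|]; first exact: cvgD (cf x Ux) (cg x Ux)) => // i.
have [f1 f2] := df i; have [g1 g2] := dg i; split=> [x Ux|].
  exact: derivableD (f1 _ Ux) (g1 _ Ux).
apply: Ck_ext (IH _ _ f2 g2) => // x Ux.
by rewrite deriveD; [|exact: f1|exact: g1].
Qed.

Lemma CkM k U f g : open U -> Ck k U f -> Ck k U g -> Ck k U (f * g).
Proof.
move=> oU; elim: k f g => [|k IH] f g Cf Cg.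
  by case: Cf Cg => cf _ [cg _]; split=> // x Ux; apply: cvgM (cf x Ux) (cg x Ux).
have [Sf Sg] := (CkS Cf, CkS Cg).
case: Cf Cg => cf df [cg dg]; split=> [x Ux|i].
  exact: cvgM (cf x Ux) (cg x Ux).
have [f1 f2] := df i; have [g1 g2] := dg i; split=> [x Ux|].
  exact: derivableM (f1 _ Ux) (g1 _ Ux).
apply: Ck_ext (CkD oU (IH _ _ Sf g2) (IH _ _ Sg f2)) => // x Ux.
by rewrite deriveM; [|exact: f1|exact: g1].
Qed.

Lemma CkV k U f : open U -> (forall x, U x -> f x != 0) ->
  Ck k U f -> Ck k U (fun x => (f x)^-1).
Proof.
move=> oU f0; elim: k f f0 => [|k IH] f f0 Cf.
  by case: Cf => cf _; split=> // x Ux; apply: cvgV (cf x Ux); exact: f0.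
have Vf := IH _ f0 (CkS Cf).
case: Cf => cf df; split=> [x Ux|i].
  by apply: cvgV (cf x Ux); exact: f0.
have [f1 f2] := df i; split=> [x Ux|].
  by apply: derivableV (f1 _ Ux); exact: f0.
apply: Ck_ext (CkM oU (CkM oU (Ck_cst k U (-1)) (CkM oU Vf Vf)) f2) => // x Ux.
rewrite deriveV; [|exact: f0|exact: f1].
by rewrite !mulrfctE /= mulN1r /GRing.scale /= expr2 invfM.
Qed.

End EuclideanSmoothness.

(* A homeomorphism from an open set of T onto an open set of R^m. *)
Record chart (R : realType) (m : nat) (T : topologicalType) := Chart {
  cdom : set T;
  cfun :> T -> 'rV[R]_m;
  cinv : 'rV[R]_m -> T;
  cdom_open : open cdom;
  ccod_open : open (cfun @` cdom);
  cfunK : forall p, cdom p -> cinv (cfun p) = p;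
  cfun_continuous : forall p, cdom p -> {for p, continuous cfun};
  cinv_continuous : forall x, (cfun @` cdom) x -> {for x, continuous cinv} }.
Arguments cdom_open {R m T} c.
Arguments ccod_open {R m T} c.

Record manifold (R : realType) (m : nat) := Manifold {
  carrier :> topologicalType;
  atlas : set (chart R m carrier);
  manifold_hausdorff : hausdorff_space carrier;
  manifold_second_countable : @second_countable carrier;
  atlas_cover : forall p : carrier, exists2 c, atlas c & cdom c p;
  atlas_smooth : forall c c', atlas c -> atlas c' -> forall i,
    smooth_on (c @` (cdom c `&` cdom c')) (fun x => c' (cinv c x) 0 i) }.

Section SmoothFunctions.
Variables (R : realType) (m : nat) (M : manifold R m).

Definition smooth (f : M -> R) :=
  forall c, atlas c -> smooth_on (c @` cdom c) (f \o cinv c).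

Lemma smooth_cst (a : R) : smooth (fun=> a).
Proof. by move=> c _ k; exact: Ck_cst. Qed.
Arguments smooth_cst a : clear implicits.

Lemma smoothD (f g : M -> R) : smooth f -> smooth g -> smooth (f + g).
Proof.
move=> sf sg c ac k.
have -> : (f + g) \o cinv c = (f \o cinv c) + (g \o cinv c) by [].
by apply: CkD (ccod_open c) _ _; [exact: sf|exact: sg].
Qed.

Lemma smoothM (f g : M -> R) : smooth f -> smooth g -> smooth (f * g).
Proof.
move=> sf sg c ac k.
have -> : (f * g) \o cinv c = (f \o cinv c) * (g \o cinv c) by [].
by apply: CkM (ccod_open c) _ _; [exact: sf|exact: sg].
Qed.

Lemma smoothN (f : M -> R) : smooth f -> smooth (- f).
Proof.
move=> sf; suff -> : - f = (fun=> -1) * f by exact: smoothM (smooth_cst _) sf.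
by apply/funext => p; rewrite mulrfctE mulN1r.
Qed.

Lemma smoothV (f : M -> R) : (forall p, f p != 0) -> smooth f ->
  smooth (fun p => (f p)^-1).
Proof.
move=> f0 sf c ac k.
by apply: (@CkV _ _ _ _ (f \o cinv c)) => [|x _|]; [exact: ccod_open|exact: f0|exact: sf].
Qed.

Definition smooth_pred : {pred (M -> R)} := [pred f | `[< smooth f >]].

Lemma smooth_predP (f : M -> R) : f \in smooth_pred <-> smooth f.
Proof. by split=> [/asboolP|sf]; [|exact/asboolP]. Qed.

Lemma smooth_subring_closed : subring_closed smooth_pred.
Proof.
split=> [|f g /smooth_predP sf /smooth_predP sg|f g /smooth_predP sf /smooth_predP sg].
- by apply/smooth_predP; exact: (smooth_cst 1).
- by apply/smooth_predP/smoothD => //; exact: smoothN.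
- by apply/smooth_predP/smoothM.
Qed.
HB.instance Definition _ := GRing.isSubringClosed.Build (M -> R) smooth_pred
  smooth_subring_closed.

(* The ring (and R-algebra) C^oo(M). *)
Record Cinf := MkCinf { Cinf_fun :> M -> R; Cinf_pred : Cinf_fun \in smooth_pred }.
HB.instance Definition _ := [isSub for Cinf_fun].
HB.instance Definition _ := [Choice of Cinf by <:].
HB.instance Definition _ :=
  GRing.SubChoice_isSubComPzRing.Build _ _ Cinf (subringClosedP _).

Definition toCinf (f : M -> R) (sf : smooth f) : Cinf :=
  @MkCinf f (proj2 (smooth_predP f) sf).

Lemma Cinf_smooth (f : Cinf) : smooth f.
Proof. exact/smooth_predP/Cinf_pred. Qed.

Lemma CinfP (f g : Cinf) : (forall p, f p = g p) -> f = g.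
Proof. by move=> fg; apply/val_inj/funext. Qed.

Definition Cinf_cst (a : R) : Cinf := toCinf (smooth_cst a).

Definition Cinf_scale (a : R) (f : Cinf) : Cinf := Cinf_cst a * f.

Lemma Cinf_scaleA a b f : Cinf_scale a (Cinf_scale b f) = Cinf_scale (a * b) f.
Proof. by apply: CinfP => p; exact: mulrA. Qed.
Lemma Cinf_scale1 : left_id 1 Cinf_scale.
Proof. by move=> f; apply: CinfP => p; exact: mul1r. Qed.
Lemma Cinf_scaleDr : right_distributive Cinf_scale +%R.
Proof. by move=> a f g; apply: CinfP => p; exact: mulrDr. Qed.
Lemma Cinf_scaleDl f : {morph Cinf_scale^~ f : a b / a + b}.
Proof. by move=> a b; apply: CinfP => p; exact: mulrDl. Qed.
HB.instance Definition _ := GRing.Zmodule_isLmodule.Build R Cinf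
  Cinf_scaleA Cinf_scale1 Cinf_scaleDr Cinf_scaleDl.

(* Derivations of C^oo(M) at p, i.e. elements of T_p M. *)
Definition derivation_at (p : M) (v : Cinf -> R) :=
  scalar v /\ forall f g, v (f * g) = v f * g p + f p * v g.

End SmoothFunctions.
Arguments Cinf_cst {R m M}.

Section Tangent.
Variables (R : realType) (m : nat) (M : manifold R m) (p : M).

Definition derivation_pred : {pred (Cinf M -> R^o)} :=
  [pred v | `[< derivation_at p v >]].

Lemma derivation_predP (v : Cinf M -> R^o) :
  v \in derivation_pred <-> derivation_at p v.
Proof. by split=> [/asboolP|dv]; [|exact/asboolP]. Qed.

Lemma derivation_submod_closed : submod_closed derivation_pred.
Proof.
split=> [|a v w /derivation_predP[lv dv] /derivation_predP[lw dw]];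
  apply/derivation_predP; split=> [b f g|f g].
- by rewrite /= mulr0 addr0.
- by rewrite mul0r mulr0 addr0.
- rewrite /= !fctE lv lw /GRing.scale /= !mulrDr !mulrA [a * b]mulrC -!addrA.
  by congr (_ + _); rewrite addrCA.
- rewrite /= !fctE dv dw /GRing.scale /=.
  rewrite !mulrDr !mulrDl !mulrA [f p * a]mulrC -!addrA.
  by congr (_ + _); rewrite addrCA.
Qed.
HB.instance Definition _ := GRing.isSubmodClosed.Build R (Cinf M -> R^o)
  derivation_pred derivation_submod_closed.

Record tangent := MkTangent {
  tangent_fun :> Cinf M -> R^o; tangent_pred : tangent_fun \in derivation_pred }.
HB.instance Definition _ := [isSub for tangent_fun].
HB.instance Definition _ := [Choice of tangent by <:].
HB.instance Definition _ := [SubChoice_isSubLmodule of tangent by <:].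

Lemma tangentP (v : tangent) : derivation_at p v.
Proof. exact/derivation_predP/tangent_pred. Qed.

Definition toTangent (v : Cinf M -> R) (dv : derivation_at p v) : tangent :=
  @MkTangent v (proj2 (derivation_predP v) dv).

End Tangent.

Section Calculus.
Variables (R : realType) (m : nat) (M : manifold R m).

Lemma tangentD (p : M) (v : tangent p) f g : v (f + g) = v f + v g.
Proof. by have := (tangentP v).1 1 f g; rewrite scale1r mul1r. Qed.

Lemma tangent0 (p : M) (v : tangent p) : v 0 = 0.
Proof. by have := tangentD v 0 0; rewrite addr0 -[LHS]addr0 => /addrI. Qed.

Lemma tangentZ (p : M) (v : tangent p) a f : v (a *: f) = a * v f.
Proof. by have := (tangentP v).1 a f 0; rewrite addr0 tangent0 addr0. Qed.

Lemma tangentN (p : M) (v : tangent p) f : v (- f) = - v f.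
Proof. by apply/eqP; rewrite -addr_eq0 -tangentD addNr tangent0. Qed.

Lemma tangentM (p : M) (v : tangent p) f g : v (f * g) = v f * g p + f p * v g.
Proof. exact: (tangentP v).2. Qed.

Lemma tangent_cst (p : M) (v : tangent p) a : v (Cinf_cst a) = 0.
Proof.
have v1 : v 1 = 0.
  have := tangentM v 1 1; rewrite !mulr1 mul1r -[LHS]addr0.
  by move=> /addrI.
suff -> : Cinf_cst a = a *: (1 : Cinf M) by rewrite tangentZ v1 mulr0.
by apply: CinfP => q; rewrite /= mulr1.
Qed.

Record vfield := VField {
  vfield_fun :> forall p : M, tangent p;
  vfield_smooth : forall f, smooth (fun p => vfield_fun p f) }.

Definition lie_deriv (X : vfield) (f : Cinf M) : Cinf M :=
  toCinf (vfield_smooth X f).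

Lemma bracket_derivation (X Y : vfield) (p : M) :
  derivation_at p (fun f => X p (lie_deriv Y f) - Y p (lie_deriv X f)).
Proof.
have lin Z a f g : lie_deriv Z (a *: f + g) = a *: lie_deriv Z f + lie_deriv Z g.
  by apply: CinfP => q; exact: (tangentP (Z q)).1.
have lei Z f g : lie_deriv Z (f * g) = lie_deriv Z f * g + f * lie_deriv Z g.
  by apply: CinfP => q; exact: (tangentP (Z q)).2.
split=> [a f g|f g].
  rewrite !lin !tangentD !tangentZ mulrBr opprD -!addrA; congr (_ + _).
  by rewrite addrCA.
rewrite !lei !tangentD !tangentM /= mulrBl mulrBr.
by ring.
Qed.

Definition bracket_at (X Y : vfield) (p : M) : tangent p :=
  toTangent (bracket_derivation X Y p).

Lemma bracket_smooth (X Y : vfield) (f : Cinf M) :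
  smooth (fun p => bracket_at X Y p f).
Proof.
exact: Cinf_smooth (lie_deriv X (lie_deriv Y f) - lie_deriv Y (lie_deriv X f)).
Qed.

Definition bracket (X Y : vfield) : vfield := VField (bracket_smooth X Y).

Definition eval_at (p : M) (f : Cinf M) : R := f p.

Lemma eval_at_zmod p : zmod_morphism (eval_at p). Proof. by []. Qed.
HB.instance Definition _ p := GRing.isZmodMorphism.Build _ _ (eval_at p)
  (eval_at_zmod p).
Lemma eval_at_monoid p : monoid_morphism (eval_at p). Proof. by []. Qed.
HB.instance Definition _ p := GRing.isMonoidMorphism.Build _ _ (eval_at p)
  (eval_at_monoid p).

(* Smooth maps from M to matrices are matrices over C^oo(M); in particular
   'cV[Cinf M]_k is the space of sections of M x R^k, and 'M[Cinf M]_k that of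
   sections of M x gl(R^k). *)
Section Matrices.
Variables (k l : nat).

Definition smooth_mx (A : M -> 'M[R]_(k, l)) :=
  forall i j, smooth (fun p => A p i j).

Definition toCinf_mx (A : M -> 'M[R]_(k, l)) (sA : smooth_mx A) :
  'M[Cinf M]_(k, l) := \matrix_(i, j) toCinf (sA i j).

Definition ev (p : M) (A : 'M[Cinf M]_(k, l)) : 'M[R]_(k, l) :=
  map_mx (eval_at p) A.

Lemma ev_toCinf_mx p (A : M -> 'M[R]_(k, l)) (sA : smooth_mx A) :
  ev p (toCinf_mx sA) = A p.
Proof. by apply/matrixP => i j; rewrite !mxE. Qed.

Definition deriv_mx (p : M) (v : tangent p) (A : 'M[Cinf M]_(k, l)) :
  'M[R]_(k, l) := map_mx (fun f => v f : R) A.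

End Matrices.

Section Bundles.
Variable k : nat.

Record gl_form := GlForm {
  gl_form_fun :> forall p : M, {linear tangent p -> 'M[R]_k};
  gl_form_smooth : forall X : vfield, smooth_mx (fun p => gl_form_fun p (X p)) }.

Definition form_on (a : gl_form) (X : vfield) : 'M[Cinf M]_k :=
  toCinf_mx (gl_form_smooth a X).

Lemma zero_form_smooth (X : vfield) :
  smooth_mx (fun p => (\0 : {linear tangent p -> 'M[R]_k}) (X p)).
Proof. by move=> i j; under eq_fun do rewrite mxE; exact: smooth_cst. Qed.
Definition zero_form : gl_form := GlForm zero_form_smooth.

Record connection := Connection {
  cov :> forall p : M, tangent p -> 'cV[Cinf M]_k -> 'cV[R]_k;
  cov_linear : forall p s, linear (fun v : tangent p => cov v s);
  cov_add : forall p (v : tangent p) s t, cov v (s + t) = cov v s + cov v t;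
  cov_leibniz : forall p (v : tangent p) (f : Cinf M) s,
    cov v (f *: s) = v f *: ev p s + f p *: cov v s;
  cov_smooth : forall (X : vfield) s, smooth_mx (fun p => cov (X p) s) }.

Definition cov_on (D : connection) (X : vfield) (s : 'cV[Cinf M]_k) :
  'cV[Cinf M]_k := toCinf_mx (cov_smooth D X s).

(* R^D_{X,Y}, as an operator on sections. *)
Definition curvature (D : connection) (X Y : vfield) (s : 'cV[Cinf M]_k) :=
  cov_on D X (cov_on D Y s) - cov_on D Y (cov_on D X s)
  - cov_on D (bracket X Y) s.

(* (D_X A) s, for the connection induced by D on endomorphisms. *)
Definition cov_end (D : connection) (X : vfield) (A : 'M[Cinf M]_k)
  (s : 'cV[Cinf M]_k) := cov_on D X (A *m s) - A *m cov_on D X s.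

(* The exterior covariant derivative (d^D a)_{X,Y}, as an operator on sections. *)
Definition ext_cov (D : connection) (a : gl_form) (X Y : vfield)
    (s : 'cV[Cinf M]_k) :=
  cov_end D X (form_on a Y) s - cov_end D Y (form_on a X) s
  - form_on a (bracket X Y) *m s.

Definition mx_comm (A B : 'M[Cinf M]_k) := A *m B - B *m A.

(* [a /\ b]_{X,Y} *)
Definition wedge (a b : gl_form) (X Y : vfield) : 'M[Cinf M]_k :=
  mx_comm (form_on a X) (form_on b Y) - mx_comm (form_on a Y) (form_on b X).

Lemma deriv_mx_ev_linear l (p : M) (A : 'M[Cinf M]_(k, l)) :
  linear (fun v : tangent p => deriv_mx v A).
Proof. by move=> a v w; apply/matrixP => i j; rewrite !mxE. Qed.

Lemma deriv_mx_add l (p : M) (v : tangent p) (A B : 'M[Cinf M]_(k, l)) :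
  deriv_mx v (A + B) = deriv_mx v A + deriv_mx v B.
Proof. by apply/matrixP => i j; rewrite !mxE tangentD. Qed.

Lemma deriv_mx_smooth l (X : vfield) (A : 'M[Cinf M]_(k, l)) :
  smooth_mx (fun p => deriv_mx (X p) A).
Proof.
by move=> i j; under eq_fun do rewrite mxE; exact: (vfield_smooth X (A i j)).
Qed.

Lemma deriv_mx_leibniz (p : M) (v : tangent p) (f : Cinf M) (s : 'cV[Cinf M]_k) :
  deriv_mx v (f *: s) = v f *: ev p s + f p *: deriv_mx v s.
Proof. by apply/matrixP => i j; rewrite !mxE tangentM. Qed.


Definition triv_conn : connection :=
  Connection (fun p => @deriv_mx_ev_linear 1 p) (fun p v => @deriv_mx_add 1 p v)
    deriv_mx_leibniz (fun X => @deriv_mx_smooth 1 X).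

End Bundles.

Lemma ev_mul k l r (p : M) (A : 'M[Cinf M]_(k, l)) (B : 'M[Cinf M]_(l, r)) :
  ev p (A *m B) = ev p A *m ev p B.
Proof. exact: map_mxM. Qed.

Lemma deriv_mx_mul k l r (p : M) (v : tangent p) (A : 'M[Cinf M]_(k, l))
    (B : 'M[Cinf M]_(l, r)) :
  deriv_mx v (A *m B) = deriv_mx v A *m ev p B + ev p A *m deriv_mx v B.
Proof.
apply/matrixP => i j; rewrite !mxE.
transitivity (\sum_q (v (A i q * B q j) : R)).
  by elim/big_ind2: _ => [|f1 x1 f2 x2 <- <-|//]; rewrite ?tangent0 ?tangentD.
rewrite -big_split /=; apply: eq_bigr => q _; rewrite !mxE.
exact: tangentM.
Qed.

Lemma deriv_mx_tr k l (p : M) (v : tangent p) (A : 'M[Cinf M]_(k, l)) :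
  deriv_mx v A^T = (deriv_mx v A)^T.
Proof. by apply/matrixP => i j; rewrite !mxE. Qed.

Lemma ev_tr k l (p : M) (A : 'M[Cinf M]_(k, l)) : ev p A^T = (ev p A)^T.
Proof. by apply/matrixP => i j; rewrite !mxE. Qed.

End Calculus.

Section Metrics.
Variables (R : realType) (m : nat) (M : manifold R m) (k : nat).

(* Metrics on M x R^k, given by their Gram matrix in the standard frame. *)
Record metric := Metric {
  gram :> 'M[Cinf M]_k;
  gram_sym : gram^T = gram;
  gram_nondeg : forall p, ev p gram \in unitmx }.

Implicit Type g : metric.

Definition metric_at g (p : M) (u w : 'cV[R]_k) : R :=
  (u^T *m ev p g *m w) 0 0.

Definition metric_on g (s t : 'cV[Cinf M]_k) : Cinf M := (s^T *m gram g *m t) 0 0.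

Definition g_symmetric g p (A : 'M[R]_k) :=
  forall u w, metric_at g p (A *m u) w = metric_at g p u (A *m w).

Definition g_skew g p (A : 'M[R]_k) :=
  forall u w, metric_at g p (A *m u) w = - metric_at g p u (A *m w).

(* D g = 0 *)
Definition parallel_metric (D : connection M k) g :=
  forall p (v : tangent p) s t,
    v (metric_on g s t) =
    metric_at g p (D p v s) (ev p t) + metric_at g p (ev p s) (D p v t).

(* d = D + N with D metric and N symmetric *)
Definition is_split g (D : connection M k) (N : gl_form M k) :=
  [/\ parallel_metric D g,
      forall p v, g_symmetric g p (N p v) &
      forall p v s, triv_conn M k p v s = D p v s + N p v *m ev p s].

Let cst_mx (u : 'cV[R]_k) : 'cV[Cinf M]_k := map_mx Cinf_cst u.

Let ev_cst p u : ev p (cst_mx u) = u.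
Proof. by apply/matrixP => i j; rewrite !mxE. Qed.

Let deriv_cst p (v : tangent p) u : deriv_mx v (cst_mx u) = 0.
Proof. by apply/matrixP => i j; rewrite !mxE; exact: tangent_cst. Qed.

Let form_inj (A B : 'M[R]_k) :
  (forall u w : 'cV[R]_k, (u^T *m A *m w) 0 0 = (u^T *m B *m w) 0 0) -> A = B.
Proof.
move=> AB; apply/matrixP => i j.
have := AB (delta_mx i 0) (delta_mx j 0).
by rewrite !trmx_delta -!rowE -!colE !mxE.
Qed.

Lemma deriv_metric_on g p (v : tangent p) s t :
  v (metric_on g s t) =
  metric_at g p (deriv_mx v s) (ev p t) + metric_at g p (ev p s) (deriv_mx v t)
  + ((ev p s)^T *m deriv_mx v g *m ev p t) 0 0.
Proof.
transitivity (deriv_mx v (s^T *m gram g *m t) 0 0); first by rewrite mxE.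
have mxD (A B : 'M[R]_1) : (A + B) 0 0 = A 0 0 + B 0 0 by rewrite mxE.
rewrite !deriv_mx_mul !ev_mul deriv_mx_tr ev_tr mulmxDl !mxD /metric_at.
by rewrite addrAC.
Qed.

Lemma split_formE g D N : is_split g D N -> forall p v,
  N p v = - 2^-1 *: (invmx (ev p g) *m deriv_mx v g).
Proof.
case=> Dg Ns dE p v.
have Dcst u : D p v (cst_mx u) = - (N p v *m u).
  have := dE p v (cst_mx u); rewrite /= deriv_cst ev_cst => /eqP.
  by rewrite eq_sym addr_eq0 => /eqP.
suff H : deriv_mx v g = - 2 *: (ev p g *m N p v).
  rewrite H -scalemxAr mulKmx ?gram_nondeg // scalerA mulrNN mulVf ?scale1r //.
  by rewrite pnatr_eq0.
apply: form_inj => u w.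
have := Dg p v (cst_mx u) (cst_mx w).
rewrite deriv_metric_on !Dcst !ev_cst !deriv_cst.
have -> : metric_at g p 0 w = 0 by rewrite /metric_at trmx0 !mul0mx mxE.
have -> : metric_at g p u 0 = 0 by rewrite /metric_at mulmx0 mxE.
have mN a b : metric_at g p (- a) b = - metric_at g p a b.
  by rewrite /metric_at linearN /= !mulNmx mxE.
have Nm a b : metric_at g p a (- b) = - metric_at g p a b.
  by rewrite /metric_at mulmxN mxE.
rewrite mN Nm Ns !add0r => ->.
have mxZ a (A : 'M[R]_1) : (a *: A) 0 0 = a * A 0 0 by rewrite mxE.
rewrite /metric_at -scalemxAr -scalemxAl mxZ !mulmxA mulNr mulr_natl mulr2n.
by rewrite opprD.
Qed.

Let inv_gram g : exists H : 'M[Cinf M]_k, forall p, ev p H = invmx (ev p g).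
Proof.
have d0 p : (\det (gram g) : Cinf M) p != 0.
  have := gram_nondeg g p; rewrite unitmxE unitfE.
  by rewrite /ev (det_map_mx (eval_at p)).
exists (toCinf (smoothV d0 (Cinf_smooth _)) *: \adj (gram g)) => p.
rewrite /ev map_mxZ (map_mx_adj (eval_at p)) /invmx gram_nondeg.
by rewrite /ev (det_map_mx (eval_at p)).
Qed.

Lemma split_exists g : exists DN, is_split g DN.1 DN.2.
Proof.
have [H HE] := inv_gram g.
pose N0 p (v : tangent p) : 'M[R]_k := - 2^-1 *: (ev p H *m deriv_mx v g).
have N0lin p : linear (@N0 p).
  move=> a v w; rewrite /N0 deriv_mx_ev_linear mulmxDr scalerDr -scalemxAr.
  by rewrite !scalerA [a * _]mulrC.
pose N1 p : {linear tangent p -> 'M[R]_k} :=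
  HB.pack (@N0 p) (GRing.isLinear.Build _ _ _ _ (@N0 p) (N0lin p)).
have N1s (X : vfield M) : smooth_mx (fun p => N1 p (X p)).
  pose dg : 'M[Cinf M]_k := toCinf_mx (deriv_mx_smooth X g).
  have -> : (fun p => N1 p (X p)) = (fun p => ev p (Cinf_cst (- 2^-1) *: (H *m dg))).
    apply/funext => p; rewrite /= /N0 /ev map_mxZ map_mxM; congr (_ *: (_ *m _)).
    by rewrite -/(ev p dg) ev_toCinf_mx.
  by move=> i j; under eq_fun do rewrite mxE; exact: Cinf_smooth.
pose N := GlForm N1s.
pose D0 p (v : tangent p) s := triv_conn M k p v s - N p v *m ev p s.
have D0l p s : linear (fun v : tangent p => D0 p v s).
  move=> a v w; rewrite /D0 (cov_linear (triv_conn M k) s) linearP mulmxDl opprD.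
  rewrite -scalemxAl scalerBr -!addrA; congr (_ + _).
  by rewrite addrCA.
have D0a p (v : tangent p) s t : D0 p v (s + t) = D0 p v s + D0 p v t.
  rewrite /D0 cov_add /ev map_mxD mulmxDr opprD -!addrA; congr (_ + _).
  by rewrite addrCA.
have D0z p (v : tangent p) (f : Cinf M) s :
    D0 p v (f *: s) = v f *: ev p s + f p *: D0 p v s.
  by rewrite /D0 cov_leibniz /ev map_mxZ -scalemxAr scalerBr addrA.
have D0s (X : vfield M) s : smooth_mx (fun p => D0 p (X p) s).
  have -> : (fun p => D0 p (X p) s) =
      (fun p => ev p (cov_on (triv_conn M k) X s - form_on N X *m s)).
    apply/funext => p; rewrite /D0 /ev map_mxB map_mxM.
    rewrite -/(ev p (cov_on (triv_conn M k) X s)) -/(ev p (form_on N X)).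
    by rewrite !ev_toCinf_mx.
  by move=> i j; under eq_fun do rewrite mxE; exact: Cinf_smooth.
have GN p (v : tangent p) : ev p g *m N0 p v = - 2^-1 *: deriv_mx v g.
  by rewrite /N0 HE -scalemxAr mulKVmx ?gram_nondeg.
have NG p (v : tangent p) : (N0 p v)^T *m ev p g = - 2^-1 *: deriv_mx v g.
  rewrite -[in LHS](gram_sym g) ev_tr -trmx_mul GN linearZ /=.
  by rewrite -deriv_mx_tr gram_sym.
exists (Connection D0l D0a D0z D0s, N); split=> /=.
- move=> p v s t; rewrite deriv_metric_on /D0 /= /metric_at.
  have mxD (A B : 'M[R]_1) : (A + B) 0 0 = A 0 0 + B 0 0 by rewrite mxE.
  rewrite -mxD -mxD -mxD; congr (fun_of_matrix _ 0 0).
  rewrite linearB /= !mulmxBl mulmxBr trmx_mul -!addrA.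
  congr (_ + _); rewrite addrCA; congr (_ + _).
  rewrite !mulmxA -(mulmxA _ (N0 p v)^T) (NG p v) -(mulmxA _ (ev p g)) (GN p v).
  rewrite -!scalemxAr -!scalemxAl !scaleNr !opprK -scalerDl.
  by rewrite -[2^-1]div1r -splitr scale1r.
- move=> p v u w; rewrite /metric_at /= trmx_mul; congr (fun_of_matrix _ 0 0).
  by rewrite !mulmxA -(mulmxA _ (N0 p v)^T) (NG p v) -(mulmxA _ (ev p g)) (GN p v).
- by move=> p v s; rewrite /D0 subrK.
Qed.

Lemma split_unique g D N D' N' : is_split g D N -> is_split g D' N' ->
  (forall p v s, D p v s = D' p v s) /\ (forall p v, N p v = N' p v).
Proof.
move=> H H'; have NN p v : N p v = N' p v by rewrite (split_formE H) (split_formE H').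
split=> // p v s; case: H H' => _ _ dE [_ _ dE'].
by have := dE p v s; rewrite dE' NN => /addIr.
Qed.

Definition metric_split g := sval (cid (split_exists g)).
Definition metric_conn g : connection M k := (metric_split g).1.
Definition metric_form g : gl_form M k := (metric_split g).2.

Lemma metric_splitP g : is_split g (metric_conn g) (metric_form g).
Proof. exact: svalP (cid (split_exists g)). Qed.

End Metrics.

Section Hypersurfaces.
Variables (R : realType) (m n : nat) (M : manifold R m).
Local Notation V := 'cV[R]_n.+1.

(* A family Lambda of subspaces of R^{n+1} stands for a map to RP^n when it is
   a smooth line subbundle of the trivial bundle. *)
Implicit Type Lambda : M -> {vspace V}.

Definition is_section Lambda (s : 'cV[Cinf M]_n.+1) :=
  forall p, ev p s \in Lambda p.

Definition line_subbundle Lambda :=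
  forall p, \dim (Lambda p) = 1%N /\ exists2 s, is_section Lambda s & ev p s != 0.

(* T_L RP^n = Hom(L, R^{n+1}/L), and the differential of Lambda at p sends v to
   s(p) |-> d_v s mod Lambda_p for sections s. *)
Definition differential_vanishes Lambda p (v : tangent p) :=
  forall s, is_section Lambda s -> deriv_mx v s \in Lambda p.

Definition immersed Lambda :=
  line_subbundle Lambda /\
  forall p (v : tangent p), differential_vanishes Lambda v -> v = 0.

(* The fibres of 0 c E1 c E2 c M x R^{n+1}. *)
Record filtration := Filtration { E1 : M -> set V; E2 : M -> set V }.

Definition linear_span (S : set V) : set V :=
  [set u | forall W : {vspace V}, (forall w, S w -> w \in W) -> u \in W].

Definition contact_lift Lambda : filtration := {|
  E1 := fun p => [set u | u \in Lambda p];
  E2 := fun p => linear_span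
    [set u | exists2 s, is_section Lambda s &
       u = ev p s \/ exists X : vfield M, u = deriv_mx (X p) s] |}.

Implicit Type E : filtration.

Definition g_minus2 E p (A : 'M[R]_n.+1) :=
  (forall u, E2 E p u -> A *m u = 0) /\ (forall u, E1 E p (A *m u)).

Definition g_minus1 E p (A : 'M[R]_n.+1) :=
  (forall u, E1 E p u -> A *m u = 0) /\
  (forall u, E2 E p u -> E1 E p (A *m u)).

Definition g_zero E p (A : 'M[R]_n.+1) :=
  (forall u, E1 E p u -> E1 E p (A *m u)) /\
  (forall u, E2 E p u -> E2 E p (A *m u)).

Definition envelopes E (g : metric M n.+1) :=
  (forall p u w, E1 E p u -> E1 E p w -> metric_at g p u w = 0) /\
  (forall p v, g_zero E p (metric_form g p v)).

Definition mobius_forms E (g : metric M n.+1) (chi psi : gl_form M n.+1) :=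
  [/\ forall p v, g_minus1 E p (chi p v) /\ g_skew g p (chi p v),
      forall p v, g_minus2 E p (psi p v),
      forall X Y s, ext_cov (metric_conn g) chi X Y s =
                    curvature (metric_conn g) X Y s &
      forall X Y s, ext_cov (triv_conn M n.+1) psi X Y s +
                    wedge (metric_form g) chi X Y *m s = 0].

Definition mobius_flat E :=
  exists2 g, envelopes E g & exists chi psi, mobius_forms E g chi psi.

End Hypersurfaces.

(* For a subspace K of T: T / K is one-dimensional. *)
Definition codim_one (R : pzRingType) (T : lmodType R) (K : set T) :=
  exists v0, ~ K v0 /\ forall v, exists c, K (v - c *: v0).

(* Main.v *)
Require Import Defs.
From HB Require Import structures.
From mathcomp Require Import all_boot all_order all_algebra.
From mathcomp Require Import all_classical all_reals topology normedtype derive.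
From mathcomp Require Import lra.
Set Implicit Arguments. Unset Strict Implicit. Unset Printing Implicit Defensive.
Import GRing.Theory.
Local Open Scope classical_set_scope.
Local Open Scope ring_scope.

(** Write [d = D + N] for the splitting of the flat
    connection defined by [g], and [G] for the Gram matrix of [g]. Then
    [dG = - 2 G N] ([Lie_gram]); differentiating once more and using the flatness
    of [d] gives [(dN)_{X,Y} = 2 [N_X, N_Y]] ([exterior_derivative_form]). This
    is the statement that the [g]-symmetric part [d^D N] of the flatness equation
    of [d] vanishes. Expanding the curvature of [D = d - N] then leaves the skew
    part of that equation, [R^D_{X,Y} = - [N_X, N_Y]]
    ([curvature_metric_conn]).

    When the kernel of [N] at each point has codimension one, all the values of
    [N] at a point are multiples of a single endomorphism, so they commute and
    [D] is flat ([curvature_metric_conn_eq0]). The equations for [chi = 0] and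
    [psi = 0] then hold, and [g] itself witnesses Moebius-flatness. *)

Section Lie.
Context {R : realType} {m : nat} {M : manifold R m}.
Implicit Types X Y : vfield M.

Lemma ev_inj k l (A B : 'M[Cinf M]_(k, l)) :
  (forall p, ev p A = ev p B) -> A = B.
Proof.
move=> AB; apply/matrixP => i j; apply: CinfP => p.
by have /matrixP/(_ i j) := AB p; rewrite !mxE.
Qed.

Lemma evB k l p (A B : 'M[Cinf M]_(k, l)) : ev p (A - B) = ev p A - ev p B.
Proof. exact: map_mxB. Qed.

Lemma evD k l p (A B : 'M[Cinf M]_(k, l)) : ev p (A + B) = ev p A + ev p B.
Proof. exact: map_mxD. Qed.

Lemma evN k l p (A : 'M[Cinf M]_(k, l)) : ev p (- A) = - ev p A.
Proof. exact: map_mxN. Qed.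

Lemma evMn k l p (A : 'M[Cinf M]_(k, l)) q : ev p (A *+ q) = ev p A *+ q.
Proof. exact: (raddfMn (map_mx (eval_at p))). Qed.

Definition evE := (evD, evB, evN, evMn).

Definition Lie_mx k l X (A : 'M[Cinf M]_(k, l)) : 'M[Cinf M]_(k, l) :=
  toCinf_mx (deriv_mx_smooth X A).

Lemma ev_Lie_mx k l p X (A : 'M[Cinf M]_(k, l)) :
  ev p (Lie_mx X A) = deriv_mx (X p) A.
Proof. exact: ev_toCinf_mx. Qed.

Lemma Lie_mxB k l X (A B : 'M[Cinf M]_(k, l)) :
  Lie_mx X (A - B) = Lie_mx X A - Lie_mx X B.
Proof.
apply: ev_inj => p; rewrite evB !ev_Lie_mx.
by apply/matrixP => i j; rewrite !mxE tangentD tangentN.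
Qed.

Lemma Lie_mx0 k l X : Lie_mx X (0 : 'M[Cinf M]_(k, l)) = 0.
Proof. by rewrite -[0 in LHS](subrr 0) Lie_mxB subrr. Qed.

Lemma Lie_mxN k l X (A : 'M[Cinf M]_(k, l)) : Lie_mx X (- A) = - Lie_mx X A.
Proof. by rewrite -[- A]sub0r Lie_mxB Lie_mx0 sub0r. Qed.

Lemma Lie_mxD k l X (A B : 'M[Cinf M]_(k, l)) :
  Lie_mx X (A + B) = Lie_mx X A + Lie_mx X B.
Proof. by rewrite -[B in LHS]opprK Lie_mxB Lie_mxN opprK. Qed.

Lemma Lie_mxM k l r X (A : 'M[Cinf M]_(k, l)) (B : 'M[Cinf M]_(l, r)) :
  Lie_mx X (A *m B) = Lie_mx X A *m B + A *m Lie_mx X B.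
Proof.
by apply: ev_inj => p; rewrite evD !ev_mul !ev_Lie_mx deriv_mx_mul.
Qed.

(** This holds by the very definition of the bracket, and is the flatness of the
    trivial connection. *)
Lemma Lie_bracket k l X Y (A : 'M[Cinf M]_(k, l)) :
  Lie_mx (bracket X Y) A = Lie_mx X (Lie_mx Y A) - Lie_mx Y (Lie_mx X A).
Proof.
apply: ev_inj => p; rewrite evB !ev_Lie_mx; apply/matrixP => i j.
rewrite !mxE /=.
by congr (X p _ - Y p _); apply: CinfP => q /=; rewrite !mxE.
Qed.

End Lie.

Section MetricCurvature.
Context {R : realType} {m : nat} {M : manifold R m} {k : nat}.
Variable g : metric M k.
Implicit Types X Y : vfield M.
Let N X : 'M[Cinf M]_k := form_on (metric_form g) X.

(** The connection is metric and [N] is symmetric, so [N] contributes equally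
    through both arguments of [g]. *)
Lemma Lie_gram X : Lie_mx X g = - (g *m N X + g *m N X).
Proof.
apply: ev_inj => p; rewrite /ev map_mxN map_mxD -!/(ev p _) !ev_mul ev_Lie_mx.
rewrite ev_toCinf_mx (split_formE (metric_splitP g)) -scalemxAr.
rewrite mulKVmx ?gram_nondeg // !scaleNr -opprD opprK -scalerDl.
by rewrite -[2^-1]div1r -Num.Theory.splitr scale1r.
Qed.

Lemma gram_inj (A B : 'M[Cinf M]_k) : g *m A = g *m B -> A = B.
Proof.
move=> AB; apply: ev_inj => p; have := congr1 (ev p) AB.
by rewrite !ev_mul => /(can_inj (mulKmx (gram_nondeg g p))).
Qed.

(** Differentiate the formula for the derivative of the Gram matrix and
    antisymmetrise: by [Lie_bracket] the second derivatives of the Gram matrix cancel. *)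
Lemma exterior_derivative_form X Y :
  Lie_mx X (N Y) - Lie_mx Y (N X) - N (bracket X Y) =
  mx_comm (N X) (N Y) *+ 2.
Proof.
have second Z W : Lie_mx Z (Lie_mx W g) =
    (g *m N Z *m N W) *+ 4 - (g *m Lie_mx Z (N W)) *+ 2.
  rewrite Lie_gram Lie_mxN Lie_mxD !Lie_mxM Lie_gram -mulr2n.
  rewrite mulNmx mulmxDl -mulr2n mulrnDl mulNrn opprD opprK.
  by rewrite -mulrnA.
have := Lie_bracket X Y (gram g); rewrite !second Lie_gram => E.
apply: gram_inj; rewrite mulr2n /mx_comm !(mulmxDr, mulmxN)
  ![g *m (N _ *m N _)]mulmxA.
(* What remains is linear in the five products, so it can be checked entrywise
   over the reals. *)
move: (g *m N X *m N Y) (g *m N Y *m N X) E => a b.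
move: (g *m Lie_mx X (N Y)) (g *m Lie_mx Y (N X)) => u v.
move: (g *m N (bracket X Y)) => c E.
apply: ev_inj => p; move/(congr1 (ev p)): E; rewrite !evE.
move: (ev p a) (ev p b) (ev p u) (ev p v) (ev p c) => {}a {}b {}u {}v {}c.
move=> /matrixP E; apply/matrixP => i j; move: (E i j).
rewrite !(mxE, mulmxnE).
lra.
Qed.

Lemma cov_onE X s : cov_on (metric_conn g) X s = Lie_mx X s - N X *m s.
Proof.
have [_ _ dE] := metric_splitP g.
apply: ev_inj => p; rewrite evB ev_mul !ev_toCinf_mx.
by have /= -> := dE p (X p) s; rewrite addrK.
Qed.

(** Since [D = d - N], flatness of [d] reduces the curvature to
    [- dN + [N_X, N_Y]]. *)
Lemma curvature_metric_conn X Y s :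
  curvature (metric_conn g) X Y s = - (mx_comm (N X) (N Y) *m s).
Proof.
have dN := exterior_derivative_form X Y.
have NbE : N (bracket X Y) =
    Lie_mx X (N Y) - Lie_mx Y (N X) - mx_comm (N X) (N Y) *+ 2.
  by rewrite -dN opprB addrC subrK.
rewrite /curvature !cov_onE NbE Lie_bracket !Lie_mxB !Lie_mxM /mx_comm mulr2n.
rewrite !(mulmxDl, mulNmx, mulmxDr, mulmxN) !mulmxA.
(* The remaining identity is linear in these eight sections, which include all
   the derivatives of [s]. *)
move: (Lie_mx X (Lie_mx Y s)) (Lie_mx Y (Lie_mx X s)) => s1 s2.
move: (N X *m Lie_mx Y s) (N Y *m Lie_mx X s) => n1 n2.
move: (Lie_mx X (N Y) *m s) (Lie_mx Y (N X) *m s) => u v.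
move: (N X *m N Y *m s) (N Y *m N X *m s) => a b.
apply: ev_inj => p; rewrite !evE.
move: (ev p s1) (ev p s2) (ev p n1) (ev p n2) => {}s1 {}s2 {}n1 {}n2.
move: (ev p u) (ev p v) (ev p a) (ev p b) => {}u {}v {}a {}b.
apply/matrixP => i j; rewrite !mxE.
lra.
Qed.

Lemma curvature_metric_conn_eq0 :
  (forall p, codim_one [set v : tangent p | metric_form g p v = 0]) ->
  forall X Y s, curvature (metric_conn g) X Y s = 0.
Proof.
move=> N_ker X Y s; rewrite curvature_metric_conn.
suff -> : mx_comm (N X) (N Y) = 0 by rewrite mul0mx oppr0.
apply: ev_inj => p; rewrite evB !ev_mul !ev_toCinf_mx.
have [v0 [_ span]] := N_ker p.
have line v : exists c, metric_form g p v = c *: metric_form g p v0.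
  have [c] := span v; rewrite /= linearB linearZ /= => /eqP.
  by rewrite subr_eq0 => /eqP ?; exists c.
have [a ->] := line (X p); have [b ->] := line (Y p).
rewrite -!scalemxAl -!scalemxAr !scalerA mulrC subrr.
by apply/matrixP => i j; rewrite !mxE.
Qed.

End MetricCurvature.

Section ZeroForm.
Context {R : realType} {m : nat} {M : manifold R m} {k : nat}.
Implicit Types X Y : vfield M.

Lemma form_on_zero X : form_on (zero_form M k) X = 0.
Proof.
by apply: ev_inj => p; rewrite ev_toCinf_mx; apply/matrixP => i j; rewrite !mxE.
Qed.

Lemma cov_on0 (D : connection M k) X : cov_on D X 0 = 0.
Proof.
apply: ev_inj => p; rewrite ev_toCinf_mx.
have := cov_add D (X p) 0 0; rewrite addr0 -[LHS]addr0 => /addrI <-.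
by apply/matrixP => i j; rewrite !mxE.
Qed.

Lemma ext_cov_zero (D : connection M k) X Y s :
  ext_cov D (zero_form M k) X Y s = 0.
Proof.
by rewrite /ext_cov /cov_end !form_on_zero !mul0mx !cov_on0 !subr0.
Qed.

Lemma wedge_zero (a : gl_form M k) X Y : wedge a (zero_form M k) X Y = 0.
Proof. by rewrite /wedge /mx_comm !form_on_zero !mul0mx !mulmx0 !subr0. Qed.

End ZeroForm.

Theorem mainTheorem5 (R : realType) (m n : nat) (m_ge2 : (2 <= m)%N)
    (n_def : n = m.+1) (Sigma : manifold R m)
    (Lambda : Sigma -> {vspace 'cV[R]_n.+1}) (Lambda_imm : immersed Lambda)
    (g : metric Sigma n.+1) (g_env : envelopes (contact_lift Lambda) g)
    (N_ker : forall p : Sigma,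
       codim_one [set v : tangent p | metric_form g p v = 0]) :
  mobius_flat (contact_lift Lambda) /\
  mobius_forms (contact_lift Lambda) g
    (zero_form Sigma n.+1) (zero_form Sigma n.+1).
Proof.
suff zero_forms : mobius_forms (contact_lift Lambda) g
    (zero_form Sigma n.+1) (zero_form Sigma n.+1).
  split=> //; exists g => //.
  by exists (zero_form Sigma n.+1), (zero_form Sigma n.+1).
split=> [p v|p v|X Y s|X Y s].
- split; first by split=> u _; rewrite mul0mx //; exact: mem0v.
  by move=> u w; rewrite /metric_at !mul0mx trmx0 mulmx0 !mul0mx mxE oppr0.
- by split=> u; rewrite mul0mx //; exact: mem0v.
- by rewrite ext_cov_zero curvature_metric_conn_eq0.
- by rewrite ext_cov_zero wedge_zero mul0mx addr0.
Qed.
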